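(* Let $(P_n)_{n\ge 0}$ be the Padovan sequence: $P_0=P_1=P_2=1$ and $P_n=P_{n-2}+P_{n-3}$ for $n\ge 3$. Then for every integer $n\ge 0$: (a) $\sum_{k=0}^{n}P_{k}=P_{n+3}+P_{n+2}-2.$ (b) $\sum_{k=0}^{n}P_{2k}=P_{2n+1}+P_{2n}-1.$ (c) $\sum_{k=0}^{n}P_{2k+1}=P_{2n+2}+P_{2n+1}-1.$ *)

(* Defs.v *)
From mathcomp Require Import all_boot all_order all_algebra.

Set Implicit Arguments.
Unset Strict Implicit.
Unset Printing Implicit Defensive.

Fixpoint padovan (n : nat) : nat :=
  match n with
  | (m.+1 as m1).+2 => padovan m1 + padovan m
  | _ => 1
  end.

Lemma padovan_small : [/\ padovan 0 = 1, padovan 1 = 1 & padovan 2 = 1].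
Proof. by []. Qed.

Lemma padovan_rec (n : nat) :
  3 <= n -> padovan n = padovan (n - 2) + padovan (n - 3).
Proof. by case: n => [|[|[|n]]] // _; rewrite !subSS !subn0. Qed.

(* Main.v *)
Require Import Defs.
From mathcomp Require Import all_boot all_order all_algebra.
From mathcomp Require Import ring.
Import GRing.Theory.
Local Open Scope ring_scope.

#[local] Arguments padovan : simpl never.

(** Each identity follows by induction on [n]: the new summand, added to the old closed form, gives
    the new one after a single use of the recurrence, [padovanSSS]. *)

Lemma padovanSSS (m : nat) :
  (padovan m.+3)%:Z = (padovan m.+1)%:Z + (padovan m)%:Z.
Proof. by rewrite -PoszD. Qed.

(* MathComp world. The identities are stated in int, so that "- 2" and "- 1"
   are genuine rather than truncated subtractions. *)
Theorem corollary2p10 (n : nat) :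
  [/\ \sum_(0 <= k < n.+1) (padovan k)%:Z
        = (padovan (n + 3)%N)%:Z + (padovan (n + 2)%N)%:Z - 2,
      \sum_(0 <= k < n.+1) (padovan (2 * k)%N)%:Z
        = (padovan (2 * n + 1)%N)%:Z + (padovan (2 * n)%N)%:Z - 1
    & \sum_(0 <= k < n.+1) (padovan (2 * k + 1)%N)%:Z
        = (padovan (2 * n + 2)%N)%:Z + (padovan (2 * n + 1)%N)%:Z - 1].
Proof.
elim: n => [|n [IHa IHb IHc]]; first by rewrite !big_nat1.
(* All indices become successors of [n] or [2 * n], so that [ring] sees equal Padovan terms as the
   same atom. *)
split; rewrite big_nat_recr //= ?IHa ?IHb ?IHc !(mulnS, addnS, addSn, addn0, add0n).
(* In each case only the largest index on the right is expanded, here [n.+4]; the rest cancels. *)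
- by rewrite (padovanSSS n.+1); ring.
- by rewrite (padovanSSS (2 * n)%N); ring.
- by rewrite (padovanSSS (2 * n).+1); ring.
Qed.
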